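(* Let $t,k,n$ be integers such that $1\leq t\leq k\leq n<\infty$. Suppose that $\mathbb{F}$ is a field with $|\mathbb{F}|\geq\binom{n}{t}$. Then the graph $\Delta_t(n,k)$ is connected and isometrically embedded into the $k$-Grassmann graph $\Gamma(n,k)$. Furthermore, the diameters of $\Delta_t(n,k)$ and $\Gamma(n,k)$ are the same.
   Context: Let $\mathbb{F}$ be a (finite or infinite) field and $V=V(n,\mathbb{F})$ an $n$-dimensional vector space over $\mathbb{F}$ with a fixed ordered basis $B=(e_1,\dots,e_n)$; vectors are written in coordinates with respect to $B$ (so $V$ is identified with $\mathbb{F}^n$). The weight of $v=(v_1,\dots,v_n)$ is $\mathrm{wt}(v)=|\{i: v_i\neq 0\}|$. An $[n,k]$-linear code is a $k$-dimensional subspace $C$ of $V$; its dual is $C^\perp=\{v\in V: v\cdot c=0\ \forall c\in C\}$, where $v\cdot c=v_1c_1+\dots+v_nc_n$. $C$ has dual minimum distance at least $t+1$ if every nonzero $v\in C^\perp$ satisfies $\mathrm{wt}(v)\geq t+1$. Let $\mathcal{C}_t(n,k)$ be the set of all $[n,k]$-linear codes with dual minimum distance at least $t+1$. The $k$-Grassmann graph $\Gamma(n,k)$ has as vertices all $k$-dimensional subspaces of $V$, with $X,Y$ adjacent if and only if $\dim(X\cap Y)=k-1$. $\Delta_t(n,k)$ is the subgraph of $\Gamma(n,k)$ induced on the vertex set $\mathcal{C}_t(n,k)$. Write $d(X,Y)$ and $d_t(X,Y)$ for the distances in $\Gamma(n,k)$ and in $\Delta_t(n,k)$ respectively, with $d_t(X,Y)=\infty$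 if $X,Y$ lie in different connected components of $\Delta_t(n,k)$. $\Delta_t(n,k)$ is isometrically embedded in $\Gamma(n,k)$ if for all vertices $X,Y$ of $\Delta_t(n,k)$ one has $d_t(X,Y)=d(X,Y)=k-\dim(X\cap Y)$. The diameter of a graph is the maximum distance between two of its vertices. (For $k=n$, $\Gamma(n,n)$ is the graph with single vertex $V$.)
   Formalization: The equality of the diameters is asserted except when n = 2, k = 1 (so t = 1) and |F| = 2, where it fails: the only code is spanned by (1,1), so Δ_1(2,1) has diameter 0, while Γ(2,1) is a triangle of diameter 1. *)

(* Defs.v *)
From HB Require Import structures.
From mathcomp Require Import all_boot all_order all_algebra.
From mathcomp Require Import boolp classical_sets functions cardinality.

Set Implicit Arguments.
Unset Strict Implicit.
Unset Printing Implicit Defensive.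

Import GRing.Theory.
Local Open Scope ring_scope.
Local Open Scope classical_set_scope.

(* Vertices form a subset of an ambient type, so that a graph and its induced
   subgraphs share that type. *)
Record graph (T : eqType) := Graph { vertices : set T; adj : rel T }.

Definition induced (T : eqType) (G : graph T) (S : set T) : graph T :=
  Graph (vertices G `&` S) (adj G).

Definition has_walk (T : eqType) (G : graph T) (x y : T) (m : nat) : Prop :=
  exists p : seq T, [/\ [set` x :: p] `<=` vertices G,
    path (adj G) x p, last x p = y & size p = m].

(* [None] stands for an infinite distance. *)
Definition dist (T : eqType) (G : graph T) (x y : T) : option nat :=
  match pselect (exists m, `[< has_walk G x y m >]) with
  | left walk => Some (ex_minn walk)
  | right _ => None
  end.

Definition connected_graph (T : eqType) (G : graph T) : Prop :=
  forall x y, vertices G x -> vertices G y -> exists m, has_walk G x y m.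

(* [d] is attained, so no [d] qualifies when [G] is empty or disconnected, or
   when its distances are unbounded. *)
Definition is_diameter (T : eqType) (G : graph T) (d : nat) : Prop :=
  (exists x y, [/\ vertices G x, vertices G y & dist G x y = Some d]) /\
  (forall x y, vertices G x -> vertices G y ->
     exists2 m, dist G x y = Some m & (m <= d)%N).

Section Codes.
Variables (F : fieldType) (n : nat).
Implicit Types (u v : 'rV[F]_n) (C X Y : {vspace 'rV[F]_n}).

Definition wt v : nat := #|[pred i | v 0 i != 0]|.

Definition dotv u v : F := \sum_(i < n) u 0 i * v 0 i.

Definition dual_code C : set 'rV[F]_n :=
  [set v | forall c, c \in C -> dotv v c = 0].

Definition dual_mindist_ge C (d : nat) : Prop :=
  forall v, dual_code C v -> v != 0 -> (d <= wt v)%N.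

Definition codes (t k : nat) : set {vspace 'rV[F]_n} :=
  [set C | \dim C = k /\ dual_mindist_ge C t.+1].

Definition Grassmann (k : nat) : graph {vspace 'rV[F]_n} :=
  Graph [set X | \dim X = k] [rel X Y | (\dim (X :&: Y)%VS).+1 == k].

Definition Delta (t k : nat) : graph {vspace 'rV[F]_n} :=
  induced (Grassmann k) (codes t k).

End Codes.

Arguments codes F n t k : clear implicits.
Arguments Grassmann F n k : clear implicits.
Arguments Delta F n t k : clear implicits.

(* Main.v *)
Require Import Defs.
From HB Require Import structures.
From mathcomp Require Import all_boot all_order all_algebra.
From mathcomp Require Import boolp classical_sets functions cardinality.
From mathcomp Require Import zify.

Local Open Scope classical_set_scope.
Local Open Scope card_scope.

(** For a set [T] of [t] coordinates let [S_T] be the space of vectors that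
    vanish on [T].  A nonzero dual codeword of weight at most [t] is exactly a
    functional that kills both [C] and some [S_T], so [C] has dual distance at
    least [t + 1] iff [C + S_T = V] for each of the [N = 'C(n, t)] sets [T]
    ([dual_mindist_strength]).  The size of the field matters because a
    space over [F] is not a union of [N <= |F|] proper subspaces
    ([subspace_avoids]).

    Geodesics ([geodesic_step]).  Let [X != Y] be codes of dimension [k] and
    let [H] be a hyperplane of [X] containing [X :&: Y].  When [H + S_T] is not
    [V], it does not contain [Y], because [Y + S_T = V].  So some [z] in [Y]
    lies outside [X :&: Y] and outside all the proper sums [H + S_T]; then
    [H + <[z]>] is a code, it is adjacent to [X], and it meets [Y] in one more
    dimension.  Iterating gives a walk from [X] to [Y] of length
    [k - \dim (X :&: Y)], and no walk of the Grassmann graph is shorter, since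
    one edge changes [\dim (_ :&: Y)] by at most one.  The case [t = 0], where
    every subspace is a code, computes the distance of the Grassmann graph.

    Diameters.  The bound [k - \dim (X :&: Y) <= minn k (n - k)] has to be
    attained by two codes.  A first code is cut out of [V] by successive
    generic hyperplanes ([exists_strength]).  If [t + 2 <= n], a pair of codes
    is spread apart one dimension at a time ([spreading_step]): drop from [Y] a
    vector of [X :&: Y], leaving a hyperplane [H] of [Y], and add a vector
    outside [X + Y] and outside the proper sums [H + S_T].  This is one
    subspace more than the field is large enough for, and [small_family_avoids]
    makes up for it because [H + S_T] contains every coordinate vector off [T],
    so that some vector lies in several of the sums.  If
    [k = n] there is a single code, and if [t = k = n - 1] the codes are the
    hyperplanes orthogonal to a vector without zero entry
    ([exists_hyperplane_pair]); two of them exist iff [F] has a scalar other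
    than 0 and 1, which fails only for [n = 2] over the field with two
    elements. *)

(** * Avoiding proper subspaces *)

Section Avoidance.
Set Implicit Arguments.
Unset Strict Implicit.
Local Open Scope ring_scope.
Import GRing.Theory.
Variables (F : fieldType) (vT : vectType F).
Implicit Types (s : seq F) (r : seq {vspace vT}) (U W : {vspace vT}).

(** The affine line through [z] with direction [v] meets a subspace that does
    not contain [v] in at most one point. *)
Lemma line_avoids s r (v z : vT) :
  uniq s -> {in r, forall W, v \notin W} -> (size r < size s)%N ->
  exists2 a, a \in s & {in r, forall W, z + a *: v \notin W}.
Proof.
elim: r s => [|W r IHr] s us vr.
  by case: s {us} => // a s _; exists a; rewrite ?mem_head.
have vW : v \notin W by apply: vr; rewrite mem_head.
have {}vr : {in r, forall W, v \notin W}.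
  by move=> W' W'r; apply: vr; rewrite inE W'r orbT.
case: (boolP (has (fun a => z + a *: v \in W) s)) => [/hasP[b bs zbW]|].
  rewrite /= -ltn_predRL -(size_rem bs) => lt_rs.
  have [a ars zar] := IHr _ (rem_uniq b us) vr lt_rs.
  move: ars; rewrite (mem_rem_uniq _ us) inE /= => /andP[ab as_]; exists a => //.
  move=> W'; rewrite inE => /predU1P[->|]; last exact: zar.
  apply: contra vW => zaW; have := memvB zaW zbW.
  rewrite opprD addrACA subrr add0r -scalerBl => /(memvZ (a - b)^-1).
  by rewrite scalerA mulVf ?scale1r // subr_eq0.
move=> /hasPn sW lt_rs.
have [a as_ zar] := IHr s us vr (ltnW lt_rs); exists a => // W'.
by rewrite inE => /predU1P[->|]; [exact: sW | exact: zar].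
Qed.

(** By induction on the family: from a vector [w] that avoids all members but
    [W], move along the line with direction [w] through a point outside [W].
    The line never meets [W] when [w] is in [W]. *)
Lemma subspace_avoids s r U :
  uniq s -> {in r, forall W, ~~ (U <= W)%VS} -> (size r <= size s)%N ->
  exists2 v, v \in U & {in r, forall W, v \notin W}.
Proof.
move=> us; elim: r => [|W r IHr] Ur le_rs; first by exists 0; rewrite ?mem0v.
have [|w wU wr] := IHr _ (ltnW le_rs).
  by move=> W' W'r; apply: Ur; rewrite inE W'r orbT.
have /subvPn[z zU zW] : ~~ (U <= W)%VS by apply: Ur; rewrite mem_head.
have [wW|wW] := boolP (w \in W); last first.
  by exists w => // W'; rewrite inE => /predU1P[->|]; [|exact: wr].
have [a as_ zar] := @line_avoids s r w z us wr le_rs.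
exists (z + a *: w); first by rewrite memvD ?memvZ.
move=> W'; rewrite inE => /predU1P[->|]; last exact: zar.
by rewrite rpredDr // memvZ.
Qed.

Lemma dim_addv_line U (z : vT) : z \notin U -> \dim (U + <[z]>) = (\dim U).+1.
Proof.
move=> zU; rewrite dimv_disjoint_sum ?dim_vline.
  by rewrite (_ : z != 0) ?addn1 //; apply: contraNneq zU => ->; rewrite mem0v.
apply/eqP; rewrite -subv0; apply/subvP=> x; rewrite memv_cap => /andP[xU /vlineP[c xE]].
move: xU; rewrite memv0 xE; have [->|c0] := eqVneq c 0; first by rewrite scale0r.
by move=> /(memvZ c^-1); rewrite scalerA mulVf // scale1r => zU'; rewrite zU' in zU.
Qed.

Lemma addv_line_exchange U (w z : vT) :
  (U + <[w]>)%VS = fullv -> z \notin U -> (U + <[z]>)%VS = fullv.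
Proof.
move=> Uw zU; apply/eqP; rewrite eqEdim subvf dim_addv_line //= -Uw.
by apply: leq_trans (dimv_add_leqif _ _).1 _; rewrite dim_vline -addn1 leq_add2l leq_b1.
Qed.

Lemma capv_addv_line U W (z : vT) :
  z \notin (U + W)%VS -> ((U + <[z]>) :&: W = U :&: W)%VS.
Proof.
move=> zUW; apply: subv_anti; rewrite (capvS (addvSl _ _) (subvv W)) andbT.
apply/subvP=> x; rewrite !memv_cap => /andP[/memv_addP[u uU [_ /vlineP[c ->] ->]] xW].
rewrite xW andbT; have [->|c0] := eqVneq c 0; first by rewrite scale0r addr0.
case/negP: zUW; have -> : z = - c^-1 *: u + c^-1 *: (u + c *: z).
  by rewrite scalerDr scalerA mulVf // scale1r scaleNr addKr.
by rewrite memv_add ?memvZ.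
Qed.

End Avoidance.

(** * Strength of a code *)

Lemma exists_superset_card (I : finType) (S : {set I}) t :
  (#|S| <= t <= #|I|)%N -> exists2 T : {set I}, S \subset T & #|T| = t.
Proof.
elim: t => [|t IHt] /andP[St tI].
  by exists S => //; apply/eqP; rewrite -leqn0.
move: St; rewrite leq_eqVlt => /predU1P[St|St]; first by exists S.
have [|T ST Tt] := IHt; first by rewrite -ltnS St ltnW.
have [i iT] : exists i, i \notin T.
  apply/existsP; rewrite -negb_forall; apply: contraL tI => /forallP aT.
  by rewrite -leqNgt -Tt subset_leq_card //; apply/fintype.subsetP=> i _.
exists (i |: T)%SET; last by rewrite cardsU1 iT Tt.
by rewrite (fintype.subset_trans ST) // finset.subsetUr.
Qed.

Section Coordinates.
Set Implicit Arguments.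
Unset Strict Implicit.
Local Open Scope ring_scope.
Import GRing.Theory.
Variables (F : fieldType) (n : nat).
Implicit Types (u v w z : 'rV[F]_n) (C H U X Y Z : {vspace 'rV[F]_n}) (T : {set 'I_n}).

Definition perp u : {vspace 'rV[F]_n} := lker (linfun (mulmxr u^T)).

Definition vanishing T : {vspace 'rV[F]_n} :=
  lker (linfun (mulmxr (diag_mx (\row_i (i \in T)%:R)))).

Lemma dotvE u v : dotv u v = (v *m u^T) 0 0.
Proof. by rewrite mxE; apply: eq_bigr => i _; rewrite mxE mulrC. Qed.

Lemma memv_perp u v : (v \in perp u) = (dotv u v == 0).
Proof.
rewrite memv_ker lfunE /= dotvE.
apply/eqP/eqP => [->|E]; first by rewrite mxE.
by apply/matrixP=> i j; rewrite !ord1 [RHS]mxE.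
Qed.

Lemma dotvC u v : dotv u v = dotv v u.
Proof. by apply: eq_bigr => i _; rewrite mulrC. Qed.

Lemma dotv_delta u i : dotv u (delta_mx 0 i) = u 0 i.
Proof.
rewrite /dotv (bigD1 i) //= big1 => [|j ji]; first by rewrite mxE !eqxx mulr1 addr0.
by rewrite mxE (negPf ji) andbF mulr0.
Qed.

Lemma vanishingP T v : reflect (forall i, i \in T -> v 0 i = 0) (v \in vanishing T).
Proof.
rewrite memv_ker lfunE /= mul_mx_diag; apply: (iffP eqP) => [E i iT|vT].
  by have /matrixP/(_ 0 i) := E; rewrite !mxE iT mulr1.
apply/matrixP=> j i; rewrite !mxE ord1.
case: (boolP (i \in T)) => [/vT->|]; first by rewrite mul0r.
by rewrite mulr0.
Qed.

Lemma delta_vanishing T i : (delta_mx 0 i \in vanishing T) = (i \notin T).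
Proof.
apply/vanishingP/idP=> [|iT j jT].
  by move=> d0; apply/negP=> /d0/eqP; rewrite mxE !eqxx oner_eq0.
by rewrite mxE; case: (eqVneq j i) => [ji|]; rewrite ?andbF //; rewrite -ji jT in iT.
Qed.

Lemma eq_fullv_delta U : (forall i, delta_mx 0 i \in U) -> U = fullv.
Proof.
move=> dU; apply: subv_anti; rewrite subvf; apply/subvP=> v _.
by rewrite [v]row_sum_delta memv_suml // => i _; rewrite memvZ.
Qed.

Lemma dim_rowspace : \dim {:'rV[F]_n} = n.
Proof. by rewrite dimvf /dim /= mul1n. Qed.

Lemma dim_vanishing T : (n <= \dim (vanishing T) + #|T|)%N.
Proof.
have E : (vanishing T + \sum_(i in T) <[delta_mx 0%R i]>)%VS = fullv.
  apply: eq_fullv_delta => i; have [iT|iT] := boolP (i \in T).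
    by rewrite memvE; apply: subv_trans (addvSr _ _); apply: (sumv_sup i).
  by apply: (subvP (addvSl _ _)); rewrite delta_vanishing.
rewrite -[leqLHS]dim_rowspace -E; apply: leq_trans (dimv_add_leqif _ _).1 _; rewrite leq_add2l.
apply: leq_trans (dimv_leq_sum _ _ _) _; rewrite -sum1_card leq_sum // => i _.
by rewrite dim_vline leq_b1.
Qed.

(** Projecting along [U] kills [U] but not [z]; a coordinate of the projection
    of [z] that is not 0 gives the functional. *)
Lemma separating_functional U z :
  z \notin U -> exists2 u, (U <= perp u)%VS & z \notin perp u.
Proof.
move=> zU; pose f v := v - projv U v.
have fU v : v \in U -> f v = 0 by move=> vU; rewrite /f projv_id // subrr.
have fz : f z != 0 by apply: contraNneq zU => /subr0_eq->; rewrite memv_proj.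
have [j fzj] : exists j, f z 0 j != 0.
  apply/existsP; apply: contraNT fz; rewrite negb_exists => /forallP fz0.
  by apply/eqP/rowP=> j; rewrite [RHS]mxE; apply/eqP; move: (fz0 j); rewrite negbK.
pose u : 'rV[F]_n := \row_i f (delta_mx 0 i) 0 j.
have uE v : dotv u v = f v 0 j.
  rewrite [in RHS](row_sum_delta v) /f linear_sum -sumrB summxE; apply: eq_bigr => i _.
  by rewrite mxE linearZ /= -scalerBr [in RHS]mxE mulrC.
exists u; last by rewrite memv_perp uE.
by apply/subvP=> v /fU fv0; rewrite memv_perp uE fv0 mxE.
Qed.

Lemma perp_split C u w :
  w \in C -> w \notin perp u -> (C :&: perp u + <[w]>)%VS = C.
Proof.
move=> wC; rewrite memv_perp => uw; apply: subv_anti.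
rewrite subv_add capvSl -memvE wC /=; apply/subvP=> c cC.
pose a := dotv u c / dotv u w; rewrite -[c](subrK (a *: w)).
rewrite memv_add ?memvZ ?memv_line // memv_cap memvB ?memvZ //=.
rewrite memv_perp dotvE mulmxBl -scalemxAl mxE [X in _ + X]mxE [X in _ - X]mxE.
rewrite -!dotvE.
by rewrite divfK // subrr.
Qed.

Lemma dim_perp_split C u w :
  w \in C -> w \notin perp u -> \dim C = (\dim (C :&: perp u)).+1.
Proof.
move=> wC wu; rewrite -{1}(perp_split wC wu) dim_addv_line //.
by rewrite memv_cap negb_and wu orbT.
Qed.

(** Equivalently, [C] projects onto any [t] coordinates; over a finite field
    this says that its words form an orthogonal array of strength [t]. *)
Definition has_strength t C := forall T, #|T| = t -> (C + vanishing T)%VS = fullv.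

(** A functional that kills [vanishing T] is supported on [T], so [C] fails to
    have strength [t] iff some nonzero word of its dual has support in a
    [t]-set. *)
Lemma dual_mindist_strength t C : (t <= n)%N ->
  dual_mindist_ge C t.+1 <-> has_strength t C.
Proof.
move=> le_tn; split=> [dC T Tt|tC v vC v0].
  apply/eqP; apply/negPn/negP=> /negP CT.
  have /subvPn[z _ /separating_functional[u Uu zu]] : ~~ (fullv <= C + vanishing T)%VS.
    by apply: contra (introN idP CT) => sub; rewrite eqEsubv subvf.
  have uC : dual_code C u.
    by move=> c cC; apply/eqP; rewrite -memv_perp (subvP Uu) // (subvP (addvSl _ _)).
  have u0 : u != 0.
    apply: contraNneq zu => ->; rewrite memv_perp /dotv big1 // => i _.
    by rewrite mxE mul0r.
  have := dC _ uC u0; rewrite -Tt ltnNge => /negP[]; apply: subset_leq_card.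
  apply/fintype.subsetP=> i; rewrite inE; apply: contraNT => iT.
  rewrite -dotv_delta -memv_perp (subvP Uu) // (subvP (addvSr _ _)) //.
  by rewrite delta_vanishing.
rewrite ltnNge; apply: contra v0 => wtv.
pose S := [set i | v 0 i != 0]%SET.
have [T sST Tt] : exists2 T : {set 'I_n}, S \subset T & #|T| = t.
  by apply: exists_superset_card; rewrite card_ord le_tn andbT cardsE.
have vfull : (fullv <= perp v)%VS.
  rewrite -(tC T Tt) subv_add; apply/andP; split; apply/subvP=> c cC.
    by rewrite memv_perp vC.
  rewrite memv_perp /dotv big1 // => i _; case: (eqVneq (v 0 i) 0) => [->|vi].
    by rewrite mul0r.
  by rewrite (vanishingP _ _ cC) ?mulr0 // (fintype.subsetP sST) // inE.
apply/eqP/rowP=> i; rewrite mxE -dotv_delta; apply/eqP; rewrite -memv_perp.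
by rewrite (subvP vfull) // memvf.
Qed.

End Coordinates.

(** * Exchanging a vector of a code *)

Section Exchange.
Set Implicit Arguments.
Unset Strict Implicit.
Local Open Scope ring_scope.
Import GRing.Theory.
Variables (F : fieldType) (n : nat).
Implicit Types (u v w z : 'rV[F]_n) (C D H U X Y Z : {vspace 'rV[F]_n}) (T : {set 'I_n}).
Implicit Types (s : seq F) (W : {set 'I_n} -> {vspace 'rV[F]_n}).

Lemma family_avoids t s U W :
    uniq s -> ('C(n, t) <= size s)%N ->
    (forall T, #|T| = t -> ~~ (U <= W T)%VS) ->
  exists2 v, v \in U & forall T, #|T| = t -> v \notin W T.
Proof.
move=> us le_s UW; pose Ts := enum [set T : {set 'I_n} | #|T| == t]%SET.
have [||v vU vW] := @subspace_avoids _ _ s [seq W T | T <- Ts] U us.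
- by move=> _ /mapP[T + ->]; rewrite mem_enum inE => /eqP/UW.
- by rewrite size_map -cardE card_draws card_ord.
exists v => // T Tt; apply/vW/mapP; exists T => //.
by rewrite mem_enum inE Tt.
Qed.

Lemma exists_card_set t : (t <= n)%N -> exists T : {set 'I_n}, #|T| = t.
Proof.
move=> le_tn; have [|T _ Tt] := @exists_superset_card 'I_n finset.set0 t.
  by rewrite cards0 card_ord le_tn.
by exists T.
Qed.

(** When [H + vanishing F T] is the whole space it obstructs nothing; the proper
    subspace [D] then stands in, so that a family indexed by all [T] can be
    avoided. *)
Definition obstruction H D T :=
  if (H + vanishing F T)%VS == fullv then D else (H + vanishing F T)%VS.

Lemma notin_obstruction H D T z : z \notin obstruction H D T ->
  (H + vanishing F T)%VS != fullv -> z \notin (H + vanishing F T)%VS.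
Proof. by rewrite /obstruction => + /negPf HT; rewrite HT. Qed.

(** Each [H + vanishing F T] is the whole space or a hyperplane, as [w] completes
    it; in the latter case any vector outside completes it too. *)
Lemma strength_exchange t H w z :
    has_strength t (H + <[w]>)%VS ->
    (forall T, #|T| = t -> (H + vanishing F T)%VS != fullv ->
       z \notin (H + vanishing F T)%VS) ->
  has_strength t (H + <[z]>)%VS.
Proof.
move=> tHw zHT T Tt.
have swap x : (H + <[x]> + vanishing F T = H + vanishing F T + <[x]>)%VS.
  by rewrite -!addvA [(<[x]> + _)%VS]addvC.
rewrite swap; have [HT|HT] := eqVneq (H + vanishing F T)%VS fullv.
  by rewrite HT sumfv.
by apply: (@addv_line_exchange _ _ _ w) (zHT T Tt HT); rewrite -swap tHw.
Qed.

(** Induction from the whole space downwards.  If [C] has strength [t] and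
    dimension more than [t], then it meets each [vanishing F T] in a nonzero
    vector [w T].  Cutting [C] by [perp u] with [u] orthogonal to no [w T]
    preserves strength, since [w T] supplies the missing direction modulo
    [vanishing F T]. *)
Lemma exists_strength t k s : uniq s -> ('C(n, t) <= size s)%N ->
  (t <= k <= n)%N -> exists2 C : {vspace 'rV[F]_n}, \dim C = k & has_strength t C.
Proof.
move=> us le_s /andP[le_tk le_kn]; move: le_tk; rewrite -{1 2}(subKn le_kn).
elim: (n - k)%N => [|m IHm] le_t.
  exists fullv; first by rewrite dim_rowspace subn0.
  by move=> T _; rewrite sumfv.
(* Once m exceeds n, truncated subtraction repeats the same case. *)
case: (leqP n m) => [nm|mn].
  by move: IHm; rewrite (_ : n - m.+1 = n - m)%N; [apply; lia | lia].
have [|C dimC tC] := IHm _; first by lia.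
pose w T := vpick (C :&: vanishing F T)%VS.
have wC T : w T \in C by have := memv_pick (C :&: vanishing F T); rewrite memv_cap => /andP[].
have wT T : w T \in vanishing F T.
  by have := memv_pick (C :&: vanishing F T); rewrite memv_cap => /andP[].
have [|u _ uw] := @family_avoids t s fullv (fun T => perp (w T)) us le_s.
  move=> T Tt; apply/negP=> fw.
  have : (0 < \dim (C :&: vanishing F T))%N.
    have := dimv_sum_cap C (vanishing F T); have := dimvS (subvf (C + vanishing F T)).
    by have := dim_vanishing F T; rewrite dim_rowspace dimC Tt; lia.
  rewrite lt0n dimv_eq0 -vpick0 => /eqP[]; apply/rowP=> i; rewrite [RHS]mxE.
  by rewrite -dotv_delta; apply/eqP; rewrite -memv_perp (subvP fw) // memvf.
have {}uw T : #|T| = t -> w T \notin perp u.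
  by move=> /uw; rewrite !memv_perp dotvC.
exists (C :&: perp u)%VS.
  have [T Tt] : exists T : {set 'I_n}, #|T| = t by apply: exists_card_set; lia.
  by have := dim_perp_split (wC T) (uw T Tt); rewrite dimC; lia.
move=> T Tt; apply: subv_anti; rewrite subvf -(tC T Tt) subv_add addvSr andbT.
rewrite -{1}(perp_split (wC T) (uw T Tt)) addvS // -memvE; exact: wT.
Qed.

(** No [H + vanishing F T] that is proper contains [Y], by the strength of [Y];
    taking [X :&: Y], inside [H], as the default obstruction also keeps [z] out
    of [X]. *)
Lemma geodesic_step t k s X Y : uniq s -> ('C(n, t) <= size s)%N -> (t <= n)%N ->
    has_strength t X -> has_strength t Y -> \dim X = k -> \dim Y = k -> X != Y ->
  exists Z, [/\ has_strength t Z, \dim Z = k, (\dim (X :&: Z)).+1 = k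
    & \dim (Z :&: Y) = (\dim (X :&: Y)).+1].
Proof.
move=> us le_s le_tn tX tY dimX dimY XY.
have YX : ~~ (Y <= X)%VS by apply: contra XY => YX; rewrite eq_sym eqEdim YX dimX dimY leqnn.
have /subvPn[x xX xY] : ~~ (X <= Y)%VS.
  by apply: contra XY => XY; rewrite eqEdim XY dimX dimY leqnn.
have [u XYu xu] : exists2 u, (X :&: Y <= perp u)%VS & x \notin perp u.
  by apply: separating_functional; rewrite memv_cap negb_and xY orbT.
pose H := (X :&: perp u)%VS.
have HX : (H <= X)%VS by rewrite capvSl.
have XYH : (X :&: Y <= H)%VS by rewrite subv_cap capvSl.
have dimH : (\dim H).+1 = k by rewrite -dimX (dim_perp_split xX xu).
have [|z zY zW] := @family_avoids t s Y (obstruction H (X :&: Y)) us le_s.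
  move=> T Tt; rewrite /obstruction; case: eqP => [_|/eqP HT].
    by apply: contra YX => YXY; apply: subv_trans YXY (capvSl _ _).
  apply: contra HT => YH; apply/eqP/subv_anti; rewrite subvf -(tY T Tt) subv_add YH.
  by rewrite addvSr.
have zX : z \notin X.
  have [T Tt] := exists_card_set le_tn.
  apply: contra (zW T Tt) => zX; rewrite /obstruction.
  have zXY : z \in (X :&: Y)%VS by rewrite memv_cap zX.
  by case: eqP => // _; apply: (subvP (addvSl _ _)); apply: (subvP XYH).
have HzX : (X :&: (H + <[z]>) = H)%VS.
  by rewrite capvC capv_addv_line ?(addv_idPr HX) //; apply/capv_idPl.
exists (H + <[z]>)%VS; split.
- apply: (@strength_exchange _ _ x); first by rewrite perp_split.
  by move=> T /zW; apply: notin_obstruction.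
- by rewrite dim_addv_line //; apply: contra zX; apply: (subvP HX).
- by rewrite HzX.
rewrite capvC -vspace_modr -?memvE // (_ : Y :&: H = X :&: Y)%VS.
  by rewrite dim_addv_line // memv_cap negb_and zX.
apply: subv_anti; rewrite [X in X && _]subv_cap [X in _ && X]subv_cap.
by rewrite (subv_trans (capvSr Y H) HX) (capvSl Y H) (capvSr X Y) XYH.
Qed.

(** Together with [U] there are ['C(n, t) + 1] subspaces to avoid, one more than
    [subspace_avoids] allows.  Start from [w] outside all [W T].  If [w] is in
    [U], pick a coordinate vector ['e_i] outside [U] and move from it along [w]:
    a point ['e_i + a *: w] with [a != 0] is outside [U] and outside each [W T]
    that contains ['e_i].  At least two of the [W T] do, because at least two
    [t]-sets miss [i], and this makes up for the lost value [a = 0]. *)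
Lemma small_family_avoids t s U W : uniq s -> ('C(n, t) <= size s)%N -> (0 < t)%N ->
    (t.+2 <= n)%N -> U != fullv -> (forall T, #|T| = t -> W T != fullv) ->
    (forall T, #|T| = t -> (vanishing F T <= W T)%VS) ->
  exists2 z, z \notin U & forall T, #|T| = t -> z \notin W T.
Proof.
move=> us le_s t_gt0 lt_tn Uf Wf vW.
have [|w _ wW] := @family_avoids t s fullv W us le_s.
  by move=> T /Wf; apply: contra => fW; rewrite eqEsubv subvf.
have [wU|wU] := boolP (w \in U); last by exists w.
have [i iU] : exists i, 'e_i \notin U.
  apply/existsP; apply: contraNT Uf; rewrite negb_exists => /forallP eU.
  by apply/eqP/eq_fullv_delta=> i; apply/negPn/eU.
pose Ts := enum [set T : {set 'I_n} | #|T| == t & 'e_i \notin W T]%SET.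
have szTs : (size Ts < (size s).-1)%N.
  suff : (size Ts + 2 <= 'C(n, t))%N by lia.
  pose B := [set T : {set 'I_n} | T \subset ~: [set i] & #|T| == t]%SET.
  pose A := [set T : {set 'I_n} | #|T| == t & 'e_i \notin W T]%SET.
  have dAB : A :&: B = finset.set0.
    apply/setP=> T; rewrite !inE; apply/negP=> /andP[/andP[/eqP Tt /negP eW] /andP[Ti _]].
    apply: eW; apply: (subvP (vW T Tt)); rewrite delta_vanishing.
    by apply: contraL Ti => iT; apply/fintype.subsetPn; exists i; rewrite // !inE eqxx.
  have B2 : (2 <= #|B|)%N.
    rewrite cards_draws cardsC1 card_ord; move: t_gt0 lt_tn.
    case: (t) => // t' _; case: (n) => // -[|m] // lt_tm; rewrite binS.
    by rewrite (leq_add (_ : 1 <= _) (_ : 1 <= _))%N // bin_gt0; lia.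
  have <- : #|[set T : {set 'I_n} | #|T| == t]%SET| = 'C(n, t).
    by rewrite card_draws card_ord.
  rewrite -cardE; apply: leq_trans (_ : #|A :|: B| <= _)%N.
    by rewrite cardsU dAB cards0 subn0 leq_add2l.
  apply: subset_leq_card; apply/fintype.subsetP=> T; rewrite !inE.
  by case/orP=> /andP[].
have [||a as_ zW] := @line_avoids _ _ (rem 0 s) [seq W T | T <- Ts] w 'e_i (rem_uniq _ us).
- by move=> _ /mapP[T + ->]; rewrite mem_enum inE => /andP[/eqP Tt _]; apply: wW.
- rewrite size_map; case: (boolP (0 \in s)) => [/size_rem->//|/rem_id->].
  exact: leq_trans szTs (leq_pred _).
have a0 : a != 0 by move: as_; rewrite (mem_rem_uniq _ us) => /andP[].
exists ('e_i + a *: w).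
  by apply: contra iU => zU; rewrite -['e_i](addrK (a *: w)) memvB ?memvZ.
move=> T Tt; have [eW|eW] := boolP ('e_i \in W T); last first.
  by apply/zW/mapP; exists T => //; rewrite mem_enum inE Tt eqxx.
apply: contra (wW T Tt) => zWT; have := memvZ a^-1 (memvB zWT eW).
by rewrite addrAC subrr add0r scalerA mulVf // scale1r.
Qed.

(** Replacing the vector [d] of [X :&: Y] in [Y] by a vector [z] outside [X + Y]
    leaves [X :&: H] as the intersection with [X]. *)
Lemma spreading_step t k s X Y : uniq s -> ('C(n, t) <= size s)%N ->
    (0 < t)%N -> (t.+2 <= n)%N ->
    has_strength t Y -> \dim Y = k ->
    (X :&: Y)%VS != 0%VS -> (X + Y)%VS != fullv ->
  exists Z, [/\ has_strength t Z, \dim Z = k &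
    \dim (X :&: Y) = (\dim (X :&: Z)).+1].
Proof.
move=> us le_s t_gt0 lt_tn tY dimY; rewrite -subv0 => /subvPn[d dXY d0] XYf.
have [u _ du] := separating_functional d0.
move: (dXY); rewrite memv_cap => /andP[dX dY].
pose H := (Y :&: perp u)%VS.
have HY : (H <= Y)%VS by apply: capvSl.
have [||z zXY zW] :=
    @small_family_avoids t s (X + Y)%VS (fun T => obstruction H (vanishing F T) T)
      us le_s t_gt0 lt_tn XYf.
- move=> T Tt; rewrite /obstruction; case: ifP => [_|/negbT//].
  apply/eqP=> Tf; have /card_gt0P[i iT] : (0 < #|T|)%N by rewrite Tt.
  by move: (memvf ('e_i : 'rV[F]_n)); rewrite -Tf delta_vanishing iT.
- by move=> T _; rewrite /obstruction; case: eqP => // _; apply: addvSr.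
have zHX : z \notin (H + X)%VS.
  by apply: contra zXY; apply: subvP; rewrite addvC addvS.
exists (H + <[z]>)%VS; split.
- apply: (@strength_exchange _ _ d); first by rewrite perp_split.
  by move=> T /zW; apply: notin_obstruction.
- rewrite dim_addv_line -?dimY ?(dim_perp_split dY du) //.
  by apply: contra zHX; apply: (subvP (addvSl _ _)).
rewrite (dim_perp_split dXY du); congr (\dim _).+1.
by rewrite [RHS]capvC capv_addv_line // [RHS]capvC capvA.
Qed.

Lemma exists_spread_pair t k s m : uniq s -> ('C(n, t) <= size s)%N ->
    (0 < t)%N -> (t.+2 <= n)%N -> (t <= k <= n)%N -> (m <= minn k (n - k))%N ->
  exists X Y, [/\ has_strength t X, has_strength t Y, \dim X = k, \dim Y = k
    & \dim (X :&: Y) = (k - m)%N].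
Proof.
move=> us le_s t_gt0 lt_tn tkn; elim: m => [|m IHm] le_m.
  have [C dimC tC] := exists_strength us le_s tkn.
  by exists C, C; rewrite capvv dimC subn0.
have [|X [Y [tX tY dimX dimY dimXY]]] := IHm; first by lia.
have [||Z [tZ dimZ dimXZ]] := @spreading_step t k s X Y us le_s t_gt0 lt_tn tY dimY.
- by rewrite -dimv_eq0 dimXY; lia.
- apply/eqP=> XY; have := dimv_sum_cap X Y.
  by rewrite XY dim_rowspace dimXY dimX dimY; lia.
by exists X, Z; split=> //; lia.
Qed.

(** A set of [n - 1] coordinates misses some [i]; then ['e_i] vanishes on it and
    completes the hyperplane [perp u] to the whole space. *)
Lemma perp_strength u : (forall i, u 0 i != 0) -> (0 < n)%N ->
  has_strength n.-1 (perp u) /\ \dim (perp u) = n.-1.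
Proof.
move=> u0 n_gt0; have eu i : 'e_i \notin perp u by rewrite memv_perp dotv_delta.
split=> [T Tt|].
  have [i iT] : exists i, i \notin T.
    have : (0 < #|~: T|)%N by have := cardsC T; rewrite card_ord Tt; lia.
    by case/card_gt0P=> i; rewrite inE; exists i.
  apply: subv_anti; rewrite subvf -(perp_split (memvf 'e_i) (eu i)) addvS ?capvSr //.
  by rewrite -memvE delta_vanishing.
have := dim_perp_split (memvf _) (eu (Ordinal n_gt0)).
by rewrite capfv dim_rowspace => /(congr1 predn).
Qed.

(** The hyperplanes orthogonal to [(1, 1, ..., 1)] and [(a, 1, ..., 1)]; only
    the first contains ['e_0 - 'e_1]. *)
Lemma exists_hyperplane_pair (a : F) : a != 0 -> a != 1 -> (1 < n)%N ->
  exists X Y, [/\ has_strength n.-1 X, has_strength n.-1 Y,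
    \dim X = n.-1, \dim Y = n.-1 & X != Y].
Proof.
move=> a0 a1 n1; have n0 : (0 < n)%N := ltnW n1.
pose i0 := Ordinal n0; pose i1 := Ordinal n1.
pose u b : 'rV[F]_n := \row_i (if i == i0 then b else 1).
have u0 b : b != 0 -> forall i, u b 0 i != 0.
  by move=> b0 i; rewrite mxE; case: ifP; rewrite ?oner_eq0.
have [t1 dim1] := perp_strength (u0 1 (oner_neq0 F)) n0.
have [ta dima] := perp_strength (u0 a a0) n0.
exists (perp (u 1)), (perp (u a)); split=> //.
have dotE b : dotv (u b) ('e_i0 - 'e_i1) = b - 1.
  rewrite dotvC /dotv (bigD1 i0) //= (bigD1 i1) //= big1 => [|i /andP[ii0 ii1]].
    by rewrite !mxE !eqxx /= subr0 sub0r mul1r mulN1r addr0.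
  by rewrite !mxE (negPf ii0) (negPf ii1) andbF subrr mul0r.
apply/eqP=> E; have := memv_perp (u 1) ('e_i0 - 'e_i1).
by rewrite E memv_perp !dotE subrr eqxx subr_eq0 (negPf a1).
Qed.

End Exchange.

(** * Distances and diameters *)

Section Distances.
Set Implicit Arguments.
Unset Strict Implicit.

Lemma distE (T : eqType) (G : graph T) x y m :
  has_walk G x y m -> (forall m', has_walk G x y m' -> (m <= m')%N) ->
  dist G x y = Some m.
Proof.
move=> walk_m min_m; rewrite /dist; case: pselect => [walk|]; last first.
  by case; exists m; apply/asboolP.
case: ex_minnP => m' /asboolP walk_m' min_m'; congr Some; apply/eqP.
by rewrite eqn_leq min_m // min_m' //; apply/asboolP.
Qed.

Variables (F : fieldType) (n : nat).
Implicit Types (X Y Z : {vspace 'rV[F]_n}).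

(** Along an edge from [X] to [Z], the common hyperplane of [X] and [Z] meets
    [Y] in at least [\dim (Z :&: Y) - 1] dimensions. *)
Lemma Grassmann_walk_ge k X Y m :
  has_walk (Grassmann F n k) X Y m -> (k - \dim (X :&: Y)%VS <= m)%N.
Proof.
case=> p [+ + + <-]; elim: p X => [|Z p IHp] X pk /=.
  by move=> _ <-; rewrite capvv (pk X) ?subnn //= mem_head.
move=> /andP[/eqP XZ pZ] pY.
have {}IHp : (k - \dim (Z :&: Y)%VS <= size p)%N.
  by apply: IHp => // W Wp; apply: pk; rewrite /= inE [_ \in _]Wp orbT.
have dimZ : \dim Z = k by apply: pk; rewrite /= !inE eqxx orbT.
suff le_Z : (\dim (Z :&: Y)%VS <= (\dim (X :&: Y)%VS).+1)%N.
  by apply: (@leq_trans (k - \dim (Z :&: Y)%VS).+1); [lia | exact: IHp].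
have := dimv_sum_cap (X :&: Z) (Z :&: Y).
have : (\dim (X :&: Z + Z :&: Y)%VS <= k)%N.
  by rewrite -dimZ dimvS // subv_add capvSr capvSl.
have : (\dim (X :&: Z :&: (Z :&: Y))%VS <= \dim (X :&: Y)%VS)%N.
  by rewrite dimvS // capvS ?capvSl ?capvSr.
by lia.
Qed.

Lemma Delta_verticesP t k X : (t <= n)%N ->
  vertices (Delta F n t k) X <-> \dim X = k /\ has_strength t X.
Proof.
move=> le_tn; split=> [[/= _ [dimX dX]]|[dimX tX]]; last split=> //=.
  by split=> //; apply/dual_mindist_strength.
by split=> //; apply/dual_mindist_strength.
Qed.

Lemma Delta_walk t k (s : seq F) X Y : uniq s -> ('C(n, t) <= size s)%N ->
    (t <= n)%N ->
    vertices (Delta F n t k) X -> vertices (Delta F n t k) Y ->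
  has_walk (Delta F n t k) X Y (k - \dim (X :&: Y)%VS).
Proof.
move=> us le_s le_tn + VY; have [dimY tY] := (Delta_verticesP k Y le_tn).1 VY.
move: {-1}(k - _)%N (erefl (k - \dim (X :&: Y)%VS)%N) => m.
elim: m X => [|m IHm] X dimXY VX; have [dimX tX] := (Delta_verticesP k X le_tn).1 VX.
  exists [::]; split=> //= [W|]; first by rewrite /= inE => /eqP->.
  have /eqP XY : (X :&: Y == X)%VS by rewrite eqEdim capvSl dimX -subn_eq0 dimXY.
  by apply/eqP; rewrite eqEdim dimX dimY leqnn andbT; apply/capv_idPl.
have XY : X != Y by apply/eqP=> XY; move: dimXY; rewrite -XY capvv dimX subnn.
have [Z [tZ dimZ dimXZ dimZY]] := geodesic_step us le_s le_tn tX tY dimX dimY XY.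
have [||p [pV pZ pY szp]] := IHm Z.
- by rewrite dimZY; lia.
- by apply/(Delta_verticesP k Z le_tn).
exists (Z :: p); split=> /=; [|by rewrite dimXZ eqxx|by []|by rewrite szp].
by move=> W; rewrite /= inE => /predU1P[->|/pV].
Qed.

Lemma Grassmann_walk t k X Y m :
  has_walk (Delta F n t k) X Y m -> has_walk (Grassmann F n k) X Y m.
Proof. by case=> p [pV pX pY szp]; exists p; split=> // W /pV[]. Qed.

Lemma Delta_dist t k (s : seq F) X Y : uniq s -> ('C(n, t) <= size s)%N ->
    (t <= n)%N ->
    vertices (Delta F n t k) X -> vertices (Delta F n t k) Y ->
  dist (Delta F n t k) X Y = Some (k - \dim (X :&: Y)%VS)%N.
Proof.
move=> us le_s le_tn VX VY; apply: distE; first exact: (Delta_walk us).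
by move=> m /Grassmann_walk/Grassmann_walk_ge.
Qed.

(** Every subspace has strength 0, so that the Grassmann graph is the case
    [t = 0] of the walks between codes, for which one scalar is enough. *)
Lemma Grassmann_dist k X Y : \dim X = k -> \dim Y = k ->
  dist (Grassmann F n k) X Y = Some (k - \dim (X :&: Y)%VS)%N.
Proof.
have V0 Z : \dim Z = k -> vertices (Delta F n 0 k) Z.
  move=> dimZ; apply/Delta_verticesP => //; split=> // T /cards0_eq->.
  apply: eq_fullv_delta => i; apply: (subvP (addvSr _ _)).
  by rewrite delta_vanishing inE.
move=> /V0 VX /V0 VY; apply: distE; last exact: Grassmann_walk_ge.
by apply/Grassmann_walk/(@Delta_walk 0 k [:: 0%R]); rewrite // bin0.
Qed.

Lemma codim_cap_le k X Y : \dim X = k -> \dim Y = k ->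
  (k - \dim (X :&: Y)%VS <= minn k (n - k))%N.
Proof.
move=> dimX dimY; have := dimv_sum_cap X Y; have := dimvS (subvf (X + Y)).
by rewrite dim_rowspace; lia.
Qed.

Lemma diameter_of_spread_pair t k (s : seq F) X Y :
    uniq s -> ('C(n, t) <= size s)%N -> (t <= n)%N ->
    vertices (Delta F n t k) X -> vertices (Delta F n t k) Y ->
    (k - \dim (X :&: Y)%VS)%N = minn k (n - k) ->
  is_diameter (Delta F n t k) (minn k (n - k)) /\
  is_diameter (Grassmann F n k) (minn k (n - k)).
Proof.
move=> us le_s le_tn VX VY dXY.
have dimV Z : vertices (Delta F n t k) Z -> \dim Z = k by case.
split; split.
- by exists X, Y; split=> //; rewrite (Delta_dist us le_s) // dXY.
- move=> X' Y' VX' VY'; exists (k - \dim (X' :&: Y')%VS)%N; first exact: (Delta_dist us).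
  by apply: codim_cap_le; apply: dimV.
- exists X, Y; have [dX dY] := (dimV X VX, dimV Y VY).
  by split=> //; rewrite Grassmann_dist // dXY.
move=> X' Y' dX' dY'; exists (k - \dim (X' :&: Y')%VS)%N; first exact: Grassmann_dist.
exact: codim_cap_le.
Qed.

End Distances.

(** * Scalars and the main theorem *)

Section Scalars.
Set Implicit Arguments.
Unset Strict Implicit.
Local Open Scope ring_scope.
Import GRing.Theory.

Lemma card_le_uniq_seq (T : choiceType) (x0 : T) m :
  `I_m #<= [set: T] -> exists2 s : seq T, uniq s & size s = m.
Proof.
pose pT := isPointed.Build T x0; pose PT : pointedType := HB.pack T pT.
move=> /(@pcard_injP _ PT)[f f_inj]; exists [seq f i | i <- iota 0 m]; last first.
  by rewrite size_map size_iota.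
rewrite map_inj_in_uniq ?iota_uniq // => i j; rewrite !mem_iota => ai aj.
by apply: f_inj; apply/mem_set.
Qed.

Lemma exists_scalar_neq01 (F : fieldType) (s : seq F) m :
    uniq s -> (m <= size s)%N -> (2 <= m)%N ->
    ~ (m = 2%N /\ [set: F] #= `I_2) ->
  exists2 a : F, a != 0 & a != 1.
Proof.
move=> us ms m2 not2; apply: contrapT => no_a.
have a01 (a : F) : a != 0 -> a = 1.
  by move=> a0; apply: contrapT => /eqP a1; apply: no_a; exists a.
have s2 : (size s <= 2)%N.
  apply: (@uniq_leq_size F s [:: 0; 1] us) => a _; rewrite !inE.
  by case: eqVneq => //= /a01->.
apply: not2; split; first by lia.
apply/eq_cardSP; exists 0 => //; rewrite (_ : _ `\ _ = [set 1%R]).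
  exact: card_set1.
apply/seteqP; split=> [a /= [_ /eqP/a01]|a /= ->] //; split=> //.
by apply/eqP; rewrite oner_eq0.
Qed.
End Scalars.

(* The diameters really differ for n = 2, k = 1 (hence t = 1) and |F| = 2, where
   Delta is a single vertex and Grassmann a triangle; only there is the last
   conclusion not asserted. *)
Theorem theorem1 (F : fieldType) (n k t : nat)
    (ht : (1 <= t)%N) (htk : (t <= k)%N) (hkn : (k <= n)%N)
    (hF : `I_('C(n, t)) #<= [set: F]) :
  [/\ connected_graph (Delta F n t k),
      (forall X Y : {vspace 'rV[F]_n},
         vertices (Delta F n t k) X -> vertices (Delta F n t k) Y ->
         dist (Delta F n t k) X Y = dist (Grassmann F n k) X Y /\
         dist (Grassmann F n k) X Y = Some (k - \dim (X :&: Y)%VS)%N)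
    & ~ [/\ n = 2%N, k = 1%N & [set: F] #= `I_2] ->
      exists d : nat, is_diameter (Delta F n t k) d /\
                      is_diameter (Grassmann F n k) d].
Proof.
have le_tn : (t <= n)%N := leq_trans htk hkn.
have [s us szs] := card_le_uniq_seq 0%R hF.
have le_s : ('C(n, t) <= size s)%N by rewrite szs.
have VP := @Delta_verticesP F n t k _ le_tn.
split=> [X Y VX VY|X Y VX VY|not_exc].
- by eexists; apply: (Delta_walk us le_s le_tn VX VY).
- have dimV Z : vertices (Delta F n t k) Z -> \dim Z = k by case.
  have [dimX dimY] := (dimV X VX, dimV Y VY).
  by rewrite (Delta_dist us le_s le_tn VX VY) Grassmann_dist.
exists (minn k (n - k)).
suff [X [Y [VX VY dXY]]] : exists X Y, [/\ vertices (Delta F n t k) X,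
    vertices (Delta F n t k) Y & (k - \dim (X :&: Y)%VS)%N = minn k (n - k)].
  exact: (diameter_of_spread_pair us le_s le_tn VX VY dXY).
(* A pair attaining the bound is found for t <= n - 2, for k = n, and for
   t = k = n - 1 in turn. *)
have [lt_tn|le_nt] := leqP t.+2 n.
  have [|X [Y [tX tY dimX dimY dXY]]] :=
      @exists_spread_pair F n t k s (minn k (n - k)) us le_s ht lt_tn _ (leqnn _).
    by rewrite htk hkn.
  by exists X, Y; split; [apply/VP| apply/VP|]; rewrite // dXY subKn // geq_minl.
have [kn|kn] := eqVneq k n.
  have [|C dimC tC] := @exists_strength F n t k s us le_s; first by rewrite htk hkn.
  by exists C, C; split; [apply/VP|apply/VP|]; rewrite // capvv dimC kn subnn minn0.
have [n1 tE kE] : [/\ 1 < n, t = n.-1 & k = n.-1]%N by split; lia.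
have [||a a0 a1] := @exists_scalar_neq01 F s n us _ n1.
- by rewrite szs tE -bin_sub ?leq_pred // -subn1 subKn ?bin1 // ltnW.
- by case=> n2 F2; apply: not_exc; split=> //; lia.
have [X [Y [tX tY dimX dimY XY]]] := exists_hyperplane_pair a0 a1 n1.
rewrite -tE in tX tY; rewrite -kE in dimX dimY.
exists X, Y; split; [by apply/VP|by apply/VP|].
have VX : vertices (Delta F n t k) X by apply/VP.
have VY : vertices (Delta F n t k) Y by apply/VP.
have le_d := codim_cap_le dimX dimY.
suff lt_d : (\dim (X :&: Y)%VS < k)%N.
  apply/eqP; rewrite eqn_leq le_d geq_min.
  by apply/orP; right; apply: leq_trans (_ : _ <= 1)%N _; [lia | rewrite subn_gt0].
rewrite ltnNge; apply: contra XY => kXY.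
have XXY : (X <= X :&: Y)%VS.
  by rewrite -(geq_leqif (dimv_leqif_sup (capvSl X Y))) dimX.
by rewrite eqEdim (subv_trans XXY (capvSr _ _)) dimX dimY leqnn.
Qed.
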